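(* Let $\Gamma_1$ be a finite generating set of the Thompson group $V$. The evaluation problem of $V$ over $\Gamma_1$ for long data inputs is in $\mathsf{DCF} \cap \mathsf{DCF}^{\rm rev}$. More precisely, assuming that $\Gamma_1 \cap \{0,1\} = \varnothing$ and that the identity element $\mathbf{1}$ belongs to $\Gamma_1$, the language $$L_V = \{x^{\rm rev}\, w\, y \;:\; x, y \in \{0,1\}^*,\ w = w_1 w_2 \cdots w_n \in \Gamma_1^+ \text{ with } n\ge 1,\ w_1,\ldots,w_n \in \Gamma_1,\ \text{and } w_n \circ \cdots \circ w_1(x) = y\}$$ over the alphabet $\Gamma_1 \cup \{0,1\}$ is deterministic context-free, and its reverse $L_V^{\rm rev}$ is also deterministic context-free.
   Context: Functions are partial functions. A prefix code is a set of strings none of which is a prefix of another; it is maximal if it is not a strict subset of another prefix code. A right ideal of $\{0,1\}^*$ is a set $R$ with $R\{0,1\}^* = R$; it is generated by a unique prefix code. A right ideal morphism of $\{0,1\}^*$ is a partial function $f$ with $f(xw) = f(x)\,w$ for all $x \in {\rm Dom}(f)$, $w \in \{0,1\}^*$, whose domain and image are right ideals; ${\rm domC}(f)$ and ${\rm imC}(f)$ are the prefix codes generating ${\rm Dom}(f)$ and ${\rm Im}(f)$. Let $\mathcal{RI}^{\sf fin}$ be the monoid of injective right ideal morphisms $f$ of $\{0,1\}^*$ such that ${\rm domC}(f)$ and ${\rm imC}(f)$ are finite maximal prefix codes. Every $f \in \mathcal{RI}^{\sf fin}$ has a unique maximum extension in $\mathcal{RI}^{\sf fin}$. The Thompson group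 $V$ is the set of those elements of $\mathcal{RI}^{\sf fin}$ that are maximum extensions, with multiplication being composition followed by maximum extension. Generating sets are taken to be closed under inverse. Each $w_i\in\Gamma_1$ is a partial function on $\{0,1\}^*$, and $w_n \circ \cdots \circ w_1(x)$ denotes literal composition ($w_1$ is applied first, without maximally extending). The evaluation problem for long data inputs asks, for a word with letters $w_1,\ldots,w_n$ and $x,y\in\{0,1\}^*$, whether $w_n\circ\cdots\circ w_1(x) = y$ (the answer is no if the left side is undefined). $\mathsf{DCF}$ is the class of deterministic context-free languages, $\mathsf{DCF}^{\rm rev} = \{L : L^{\rm rev} \in \mathsf{DCF}\}$; $x^{\rm rev}$ is the reverse of the string $x$ and $L^{\rm rev}=\{z^{\rm rev}: z\in L\}$. *)

(* Defs.v *)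
From mathcomp Require Import all_boot.
From mathcomp Require Import boolp classical_sets functions cardinality.
From Stdlib Require Import Relation_Operators.

Set Implicit Arguments.
Unset Strict Implicit.
Unset Printing Implicit Defensive.

Local Open Scope classical_set_scope.

Notation bitstring := (seq bool).

(* Partial functions on {0,1}^*; [None] means undefined.  Composition is
   ssrfun's [pcomp f g = fun x => obind f (g x)] and the identity is [Some]. *)
Notation pfun := (bitstring -> option bitstring).

Definition Dom (f : pfun) : set bitstring := [set x | exists y, f x = Some y].
Definition Im (f : pfun) : set bitstring := [set y | exists x, f x = Some y].

Definition pinjective (f : pfun) : Prop :=
  forall x1 x2 y, f x1 = Some y -> f x2 = Some y -> x1 = x2.

Definition extends (f g : pfun) : Prop :=
  forall x y, f x = Some y -> g x = Some y.

(* P {0,1}^* *)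
Definition rclosure (P : set bitstring) : set bitstring :=
  [set x ++ w | x in P & w in setT].

Definition right_ideal (R : set bitstring) : Prop := rclosure R = R.

Definition prefix_code (P : set bitstring) : Prop :=
  forall x y, P x -> P y -> prefix x y -> x = y.

Definition maximal_prefix_code (P : set bitstring) : Prop :=
  prefix_code P /\ forall Q, prefix_code Q -> ~ P `<` Q.

(* A right ideal has a unique generating prefix code, so domC and imC are
   rendered as functional relations. *)
Definition is_code_of (R P : set bitstring) : Prop :=
  prefix_code P /\ rclosure P = R.
Definition is_domC (f : pfun) : set bitstring -> Prop := is_code_of (Dom f).
Definition is_imC (f : pfun) : set bitstring -> Prop := is_code_of (Im f).

Definition right_ideal_morphism (f : pfun) : Prop :=
  [/\ right_ideal (Dom f), right_ideal (Im f)
    & forall x y w, f x = Some y -> f (x ++ w) = Some (y ++ w)].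

Definition RIfin : set pfun := [set f |
  [/\ right_ideal_morphism f, pinjective f,
      exists P, [/\ is_domC f P, finite_set P & maximal_prefix_code P]
    & exists Q, [/\ is_imC f Q, finite_set Q & maximal_prefix_code Q]]].

Definition is_max_extension (f g : pfun) : Prop :=
  [/\ RIfin g, extends f g & forall h, RIfin h -> extends f h -> extends h g].

Definition thompsonV : set pfun :=
  [set g | exists2 f, RIfin f & is_max_extension f g].

(* h is the product f g in V (g is applied first). *)
Definition is_Vprod (f g h : pfun) : Prop := is_max_extension (pcomp f g) h.

Inductive Vgenerated (G : set pfun) : set pfun :=
| Vgenerated1 : Vgenerated G Some
| VgeneratedM g f h :
    G g -> Vgenerated G f -> is_Vprod g f h -> Vgenerated G h.

Definition V_inverse_closed (G : set pfun) : Prop :=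
  forall g, G g -> exists2 h, G h & is_Vprod g h Some /\ is_Vprod h g Some.

Definition V_generating_set (G : set pfun) : Prop :=
  [/\ G `<=` thompsonV, V_inverse_closed G & thompsonV `<=` Vgenerated G].

(* Deterministic pushdown automata with epsilon-moves, accepting by final
   state; the head of the stack list is its top, and every move pops the top
   symbol and replaces it by a word. *)
Record dpda (A : finType) := DPDA {
  dstate : finType;
  dstack : finType;
  dstart : dstate;
  dbottom : dstack;
  dfinal : {set dstate};
  dtrans : dstate -> option A -> dstack -> option (dstate * seq dstack);
  dtrans_det : forall q a z,
    dtrans q None z <> None -> dtrans q (Some a) z = None
}.

Definition dconfig (A : finType) (M : dpda A) : Type :=
  (dstate M * seq A * seq (dstack M))%type.

Inductive dstep (A : finType) (M : dpda A) : dconfig M -> dconfig M -> Prop :=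
| dstep_read q a u z s q' t :
    dtrans q (Some a) z = Some (q', t) ->
    dstep (q, a :: u, z :: s) (q', u, t ++ s)
| dstep_eps q u z s q' t :
    dtrans q None z = Some (q', t) ->
    dstep (q, u, z :: s) (q', u, t ++ s).

Definition dpda_lang (A : finType) (M : dpda A) : set (seq A) :=
  [set u | exists q s,
    clos_refl_trans _ (@dstep A M)
      (dstart M, u, [:: dbottom M]) (q, [::], s) /\ q \in dfinal M].

Definition DCF (A : finType) : set (set (seq A)) :=
  [set L | exists M : dpda A, dpda_lang M = L].

Definition rev_lang (A : finType) (L : set (seq A)) : set (seq A) :=
  [set rev z | z in L].

Definition DCFrev (A : finType) : set (set (seq A)) :=
  [set L | DCF (rev_lang L)].

(* [word_fun ev [:: w1; ..; wn]] is wn o .. o w1, without maximal extension. *)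
Definition word_fun (Gamma : Type) (ev : Gamma -> pfun) (w : seq Gamma) : pfun :=
  foldl (fun f a => pcomp (ev a) f) Some w.

(* Gamma is a finite set of letters, the letter a naming the partial function
   [ev a].  The alphabet is the disjoint union of Gamma and {0,1}. *)
Definition L_V (Gamma : finType) (ev : Gamma -> pfun) :
    set (seq (Gamma + bool)%type) :=
  [set u | exists x w y,
    [/\ (0 < size w)%N, word_fun ev w x = Some y
      & u = map inr (rev x) ++ map inl w ++ map inr y]].

(* Main.v *)
Require Import Defs.
From mathcomp Require Import all_boot.
From mathcomp Require Import boolp classical_sets functions cardinality.
From Stdlib Require Import Relation_Operators.

(** A right ideal morphism whose domain code is finite is a prefix rewriting:
    once [u] is at least as long as every word of the code, [f (u ++ v)] is
    [f u] followed by [v], defined or not ([prefix_localP]).  So if a pushdown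
    stack holds a string with its first bit on top, applying such an [f] only
    touches a bounded part of the stack near the top.

    A pushdown automaton therefore decides [L_V] directly.  Pushing [rev x]
    bit by bit leaves [x] on the stack with its first bit on top, each letter
    of the word rewrites the top of the stack, and the bits of [y] are then
    compared with the stack while it is popped; acceptance means that the
    stack ends up empty ([accepts_reading_x]).  The step that looks at [K]
    symbols at once is compiled once and for all into one-symbol pushdown moves,
    by keeping the top [K] symbols in the finite control
    ([prefix_machine_DCF]).

    For the reversed language, reading [rev u] for [u] in [L_V] means reading
    [rev y], then the letters in reverse order, then [x]; undoing the letters
    one by one turns [y] into [x].  As the generators are injective,
    [rev_lang (L_V ev)] is exactly the language [L_V] of the inverse partial
    functions ([rev_lang_L_V]).  The inverse of an injective right ideal
    morphism again commutes with appending words, and its domain code is the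
    image code, which is finite as well; so the same automaton applies. *)

Set Implicit Arguments.
Unset Strict Implicit.
Unset Printing Implicit Defensive.

Local Open Scope classical_set_scope.

(** * Automata rewriting a bounded prefix of their memory *)

Section PrefixMachine.

Variables (A Q T : finType) (K : nat).
Variable delta : Q -> A -> seq T -> option (Q * seq T).
Variables (q0 : Q) (F : pred Q).

Hypothesis K_gt0 : 0 < K.
Hypothesis delta_local : forall q a u v, K <= size u ->
  delta q a (u ++ v) = omap (fun c => (c.1, c.2 ++ v)) (delta q a u).

Fixpoint accepts (q : Q) (s : seq T) (w : seq A) : bool :=
  if w is a :: w' then
    if delta q a s is Some c then accepts c.1 c.2 w' else false
  else F q && nilp s.

Lemma size_take_bound (s : seq T) : size (take K s) <= K.
Proof. by rewrite size_take_min geq_minl. Qed.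

Definition buffer (s : seq T) : K.-bseq T := Bseq (size_take_bound s).

Lemma bufferK (s : seq T) : size s <= K -> buffer s = s :> seq T.
Proof. exact: take_oversize. Qed.

(** In a state [(q, u, ready)] the memory of the machine is the buffer [u]
    followed by the stack above the bottom marker [None].  The flag [ready]
    tells that [u] has been filled up to length [K], or that the bottom of the
    stack is exposed.  It makes the automaton deterministic, since epsilon-moves
    and reading moves then never share a state; and it makes the emptiness of
    the whole memory visible in the state alone, as acceptance by final state
    requires. *)
Definition pm_state : finType := (Q * K.-bseq T * bool)%type.

Definition pm_trans (p : pm_state) (x : option A) (z : option T) :
    option (pm_state * seq (option T)) :=
  let: (q, u, ready) := p in
  if ready then
    if x is Some a then
      omap (fun c => ((c.1, buffer c.2, false),
                      rcons (map Some (drop K c.2)) z))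
           (delta q a u)
    else None
  else if x is Some _ then None
  else if (z, size u < K) is (Some t, true) then
    Some ((q, buffer (rcons u t), false), [::])
  else Some ((q, u, true), [:: z]).

Lemma pm_trans_det p a z :
  pm_trans p None z <> None -> pm_trans p (Some a) z = None.
Proof. by case: p => [[q u] []]. Qed.

Definition pm_final : {set pm_state} :=
  finset (fun p : pm_state => [&& p.2, F p.1.1 & nilp p.1.2]).

Definition pm_dpda : dpda A :=
  @DPDA A pm_state (option T) (q0, buffer [::], false) None pm_final pm_trans
    pm_trans_det.

Definition pm_stack (s : seq T) : seq (option T) := rcons (map Some s) None.

Let reaches := clos_refl_trans _ (@dstep A pm_dpda).

(** Filling the buffer does not change the whole memory [u ++ s], and a reading
    move performs one step of the machine on it; hence the verdict [b] of the
    machine on the remaining input never changes. *)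
Definition pm_inv (b : bool) (c : dconfig pm_dpda) : Prop :=
  let: ((q, u, ready), w, st) := c in
  exists s, [/\ st = pm_stack s, ready -> K <= size u \/ s = [::]
              & accepts q (u ++ s) w = b].

Lemma delta_ready q a (u s : seq T) : K <= size u \/ s = [::] ->
  delta q a (u ++ s) = omap (fun c => (c.1, c.2 ++ s)) (delta q a u).
Proof.
case=> [/delta_local-> //|->].
by rewrite cats0; case: (delta q a u) => //= -[? ?] /=; rewrite cats0.
Qed.

Lemma pm_inv_step b c c' : dstep c c' -> pm_inv b c -> pm_inv b c'.
Proof.
case=> [[[q u] ready] a w z st q' t|[[q u] ready] w z st q' t] /=.
  case: ready => //; case E: (delta q a u) => [[q1 s1]|] //= [<- <-].
  case=> s [st_s /(_ isT) /(delta_ready q a) Eus]; rewrite /= Eus E /= => <-.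
  exists (drop K s1 ++ s); split=> //; last by rewrite /= catA cat_take_drop.
  by rewrite cat_rcons st_s /pm_stack map_cat rcons_cat.
case: ready => // Et [s [st_s _ acc]].
case: s => [|t0 s] in st_s acc *; case: st_s Et => -> ->.
  by case=> <- <-; exists [::]; split=> //; right.
case: ltnP => [u_lt|u_ge] [<- <-].
  exists s; split=> //; rewrite bufferK ?size_rcons //.
  by rewrite cat_rcons.
by exists (t0 :: s); split=> // _; left.
Qed.

Lemma pm_inv_reaches b c c' : reaches c c' -> pm_inv b c -> pm_inv b c'.
Proof.
elim=> [{}c {}c'|//|c1 c2 c3 _ IH1 _ IH2 /IH1/IH2 //].
exact: pm_inv_step.
Qed.

(** The epsilon-moves terminate, with a buffer long enough for [delta] to act on
    it alone. *)
Lemma pm_load q (u : K.-bseq T) s w : exists (u' : K.-bseq T) s',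
  [/\ u' ++ s' = u ++ s, K <= size u' \/ s' = [::]
    & reaches (((q, u, false) : dstate pm_dpda), w, pm_stack s)
              (((q, u', true) : dstate pm_dpda), w, pm_stack s')].
Proof.
elim: s u => [|t s IH] u.
  exists u, [::]; split; [by []|by right|].
  apply: rt_step.
  exact: (@dstep_eps A pm_dpda (q, u, false) w None _ (q, u, true) [:: None]).
case: (ltnP (size u) K) => u_K.
  have [u' [s' [eq_us ready r]]] := IH (buffer (rcons u t)).
  exists u', s'; split=> //.
    by rewrite eq_us bufferK ?size_rcons // cat_rcons.
  apply: rt_trans r; apply: rt_step.
  apply: (@dstep_eps A pm_dpda (q, u, false) w (Some t) (pm_stack s) _ [::]).
  by rewrite /= u_K.
exists u, (t :: s); split; [by []|by left|].
apply: rt_step.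
apply: (@dstep_eps A pm_dpda (q, u, false) w (Some t) _ (q, u, true) [:: Some t]).
by rewrite /= ltnNge u_K.
Qed.

Lemma pm_complete q (u : K.-bseq T) s w : accepts q (u ++ s) w ->
  exists p st, reaches (((q, u, false) : dstate pm_dpda), w, pm_stack s)
                       (p, [::], st) /\ p \in dfinal pm_dpda.
Proof.
elim: w => [|a w IH] in q u s *.
  have [u' [s' [<- _ r]]] := pm_load q u s [::].
  move=> /andP[Fq /nilP us0]; exists (q, u', true), (pm_stack s').
  split=> //.
  by rewrite finset.in_set /= Fq; case: (val u') us0.
have [u' [s' [<- ready r]]] := pm_load q u s (a :: w).
rewrite /= (delta_ready q a ready); case E: (delta q a u') => [[q1 s1]|] //=.
rewrite -{1}(cat_take_drop K s1) -catA => /(IH q1 (buffer s1)) [p [st [r' pF]]].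
exists p, st; split=> //; apply: rt_trans r _; apply: rt_trans r'.
(* The automaton pops its top stack symbol [z] on reading and restores it under
   the overflow of the buffer. *)
have [z [st' stE]] : exists z st', pm_stack s' = z :: st'.
  by case: (s') => [|t s2]; [exists None, [::]|exists (Some t), (pm_stack s2)].
have -> : pm_stack (drop K s1 ++ s') = rcons (map Some (drop K s1)) z ++ st'.
  by rewrite cat_rcons -stE /pm_stack map_cat rcons_cat.
by rewrite stE; apply: rt_step; apply: dstep_read; rewrite /= E.
Qed.

(** A machine whose moves depend on at most [K] leading symbols of its memory
    is a deterministic pushdown automaton in disguise: the leading symbols fit
    in the finite control. *)
Theorem prefix_machine_DCF : @DCF A [set w | accepts q0 [::] w].
Proof.
exists pm_dpda; apply/seteqP; split=> w /=.
  move=> [[[q u] ready] [st [/(pm_inv_reaches (b := accepts q0 [::] w)) inv]]].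
  rewrite finset.in_set => /and3P[/= ready_t Fq /nilP u0].
  have [|s [_ rdy acc]] := inv; first by exists [::]; split.
  suff s0 : s = [::] by rewrite -acc u0 s0 /= Fq.
  by case: (rdy ready_t) => //; rewrite u0 leqNgt K_gt0.
by move=> acc; apply: (@pm_complete q0 (buffer [::]) [::] w).
Qed.

End PrefixMachine.

(** * Partial functions rewriting a bounded prefix *)

Definition prefix_local (K : nat) (f : pfun) : Prop :=
  forall u v, K <= size u -> f (u ++ v) = omap (cat^~ v) (f u).

Lemma prefix_local_leq K K' f :
  K <= K' -> prefix_local K f -> prefix_local K' f.
Proof. by move=> le_K fK u v /(leq_trans le_K); apply: fK. Qed.

(** [K] bounds the lengths in the domain code: a word [u] of length at least
    [K] that has an extension in the domain has itself a prefix in the code. *)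
Lemma prefix_localP (f : pfun) (P : set bitstring) :
    (forall x y w, f x = Some y -> f (x ++ w) = Some (y ++ w)) ->
    rclosure P = Dom f -> finite_set P ->
  exists K, prefix_local K f.
Proof.
move=> f_cat domP /finite_seqP[r Pr].
exists (\max_(p <- r) size p) => u v u_long.
case fu: (f u) => [y|] /=; first exact: f_cat.
case fuv: (f (u ++ v)) => [z|] //.
have : Dom f (u ++ v) by exists z.
rewrite -domP => -[p Pp [t _ eq_pt]].
have p_u : size p <= size u.
  apply: leq_trans u_long; move: Pp; rewrite Pr /= => pr.
  exact: (@leq_bigmax_seq _ r xpredT size).
have : Dom f u.
  rewrite -domP; exists p => //; exists (drop (size p) u) => //.
  have := congr1 (take (size p)) eq_pt.
  rewrite take_size_cat // takel_cat // => {1}->.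
  exact: cat_take_drop.
by case=> y; rewrite fu.
Qed.

Definition pinv (f : pfun) : pfun := fun y =>
  if pselect (exists x, f x = Some y) is left ex_x
  then Some (projT1 (cid ex_x)) else None.

Lemma pinvP f x y : pinjective f -> (pinv f y = Some x) <-> (f x = Some y).
Proof.
move=> f_inj; rewrite /pinv; case: pselect => [ex_x|nex]; last first.
  by split=> // fx; case: nex; exists x.
case: cid => x' /= fx'; split=> [[<-] //|fx].
by congr Some; apply: f_inj fx' fx.
Qed.

Lemma RIfin_local f : RIfin f -> exists K, prefix_local K f.
Proof.
move=> [[_ _ f_cat] _ [P [[_ domP] finP _]] _].
exact: prefix_localP f_cat domP finP.
Qed.

Lemma RIfin_pinv_local f : RIfin f -> exists K, prefix_local K (pinv f).
Proof.
move=> [[_ _ f_cat] f_inj _ [P [[_ imP] finP _]]].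
apply: (@prefix_localP _ P) => //.
  by move=> y x w /(pinvP _ _ f_inj)/f_cat ?; apply/(pinvP _ _ f_inj).
rewrite imP; apply/seteqP.
by split=> y [x] /(pinvP _ _ f_inj) fx; exists x.
Qed.

(** * The language of long data evaluation *)

Section Evaluation.

Variables (Gamma : finType) (ev : Gamma -> pfun).

Lemma word_fun_rcons w a x :
  word_fun ev (rcons w a) x = obind (ev a) (word_fun ev w x).
Proof. by rewrite /word_fun foldl_rcons. Qed.

Lemma word_fun_cons a w x :
  word_fun ev (a :: w) x = obind (word_fun ev w) (ev a x).
Proof.
elim/last_ind: w => [|w b IH].
  by rewrite /word_fun /= /pcomp /=; case: (ev a x).
rewrite -rcons_cons word_fun_rcons IH; case: (ev a x) => //= y.
by rewrite word_fun_rcons.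
Qed.

(** Which of the three parts of [rev x ++ w ++ y] the last symbol read belongs
    to; [option bool] serves as a finite type with three elements.  A word with
    at least one letter has been read exactly when [reading_x] has been left. *)
Definition reading_x : option bool := None.
Definition reading_w : option bool := Some false.
Definition reading_y : option bool := Some true.

Definition L_V_step (p : option bool) (c : Gamma + bool) (s : bitstring) :
    option (option bool * bitstring) :=
  match c with
  | inl a => if p == reading_y then None
             else omap (pair reading_w) (ev a s)
  | inr b => if p == reading_x then Some (reading_x, b :: s)
             else if s is b' :: s' then
               if b == b' then Some (reading_y, s') else None
             else None
  end.

Lemma L_V_step_local K : 0 < K -> (forall a, prefix_local K (ev a)) ->
  forall p c u v, K <= size u ->
  L_V_step p c (u ++ v) = omap (fun c => (c.1, c.2 ++ v)) (L_V_step p c u).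
Proof.
move=> K_gt0 ev_K p [a|b] u v u_K /=; case: ifP => // _.
  by rewrite ev_K //; case: (ev a u).
by case: u u_K => [|b' u] /=; [rewrite leqNgt K_gt0|case: eqP].
Qed.

Let acc := accepts L_V_step (predC1 reading_x).

Lemma accepts_reading_y s v :
  reflect (v = map inr s) (acc reading_y s v).
Proof.
elim: v s => [|[a|b] v IH] [|b' s] /=; try by constructor.
rewrite /acc /=; case: eqP => [<-|ne] /=; last by constructor=> -[].
by apply: (iffP (IH s)) => [->|[]].
Qed.

Lemma accepts_reading_w s v :
  acc reading_w s v <-> exists w y,
    word_fun ev w s = Some y /\ v = map inl w ++ map inr y.
Proof.
elim: v s => [|[a|b] v IH] s.
- split=> [/nilP->|[[|a w] [[|b y] [// [->]]]] //]; by exists [::], [::].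
- rewrite /acc /=; case E: (ev a s) => [s'|] /=; last first.
    split=> // -[[|a' w] [y [wE vE]]]; first by case: (y) vE.
    by case: vE wE => <- _; rewrite word_fun_cons E.
  rewrite -/(acc _ _ _) IH; split=> -[w [y [wE vE]]].
    by exists (a :: w), y; rewrite word_fun_cons E vE.
  case: w wE vE => [_|a' w wE [eq_a ->]]; first by case: (y).
  by exists w, y; move: wE; rewrite -eq_a word_fun_cons E.
- have -> : acc reading_w s (inr b :: v) = acc reading_y s (inr b :: v) by [].
  split=> [/accepts_reading_y ->|]; first by exists [::], s.
  by case=> -[|a w] [y [wE vE]] //; case: wE vE => -> vE; apply/accepts_reading_y.
Qed.

(** Pushing the bits of [x] one by one on [s] leaves [catrev x s], that is
    [rev x ++ s]: this is why [L_V] spells the argument backwards. *)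
Lemma accepts_reading_x s v :
  acc reading_x s v <-> exists x w y,
    [/\ 0 < size w, word_fun ev w (catrev x s) = Some y
      & v = map inr x ++ map inl w ++ map inr y].
Proof.
elim: v s => [|[a|b] v IH] s.
- by split=> // -[[|? ?] [[|? ?] [? []]]].
- have -> : acc reading_x s (inl a :: v) = acc reading_w s (inl a :: v) by [].
  rewrite accepts_reading_w; split=> [[w [y [wE vE]]]|[x [w [y [w0 wE vE]]]]].
    exists [::], w, y; split=> //; by case: (w) (y) vE => [|? ?] [].
  case: x wE vE => [|? ?] //= wE vE; by exists w, y.
- rewrite [acc _ _ _]/= -/(acc _ _ _) IH.
  split=> [[x [w [y [w0 wE ->]]]]|[x [w [y [w0 wE vE]]]]].
    by exists (b :: x), w, y.
  case: x wE vE => [|b' x] wE; first by case: (w) w0.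
  by case=> -> ->; exists x, w, y.
Qed.

Lemma L_V_DCF : (forall a, exists K, prefix_local K (ev a)) ->
  @DCF (Gamma + bool)%type (L_V ev).
Proof.
move=> /choice[K_ K_local].
(* The successor makes [K] positive, as the comparison with [y] looks at one
   bit even when no letter does. *)
pose K := (\max_a K_ a).+1.
have ev_K a : prefix_local K (ev a).
  by apply: prefix_local_leq (K_local a); rewrite leqW // leq_bigmax.
suff -> : L_V ev = [set v | acc reading_x [::] v].
  exact: prefix_machine_DCF (ltn0Sn _) (L_V_step_local (ltn0Sn _) ev_K).
apply/seteqP; split=> v /=.
  move=> [x [w [y [w0 wE ->]]]]; apply/accepts_reading_x.
  by exists (rev x), w, y; rewrite -/(rev (rev x)) revK.
move=> /accepts_reading_x[x [w [y [w0 wE ->]]]].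
by exists (rev x), w, y; rewrite revK.
Qed.

End Evaluation.

Lemma word_fun_pinv (Gamma : finType) (ev : Gamma -> pfun) w x y :
    (forall a, pinjective (ev a)) ->
  word_fun (fun a => pinv (ev a)) (rev w) y = Some x <->
  word_fun ev w x = Some y.
Proof.
move=> ev_inj; elim: w x => [|a w IH] x; first by split=> -[->].
rewrite rev_cons word_fun_rcons word_fun_cons; split.
  case E: (word_fun _ _ y) => [z|] //= /(pinvP _ _ (ev_inj a)) -> /=.
  exact/IH.
case E: (ev a x) => [z|] //= /IH -> /=.
exact/(pinvP _ _ (ev_inj a)).
Qed.

(** The letters are undone from the last to the first, which is the order in
    which the reversed word spells them. *)
Lemma rev_lang_L_V (Gamma : finType) (ev : Gamma -> pfun) :
    (forall a, pinjective (ev a)) ->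
  rev_lang (L_V ev) = L_V (fun a => pinv (ev a)).
Proof.
move=> ev_inj; apply/seteqP; split=> v.
  move=> [_ [x [w [y [w0 /(word_fun_pinv _ _ _ ev_inj) wE ->]]]] <-].
  exists y, (rev w), x; split; rewrite ?size_rev //.
  by rewrite !rev_cat -!map_rev revK catA.
move=> [y [w [x [w0 wE ->]]]].
exists (map inr (rev x) ++ map inl (rev w) ++ map inr y).
  exists x, (rev w), y; split; rewrite ?size_rev //.
  by apply/(word_fun_pinv _ _ _ ev_inj); rewrite revK.
by rewrite !rev_cat -!map_rev !revK catA.
Qed.

Theorem proposition4p1 (Gamma1 : finType) (ev : Gamma1 -> pfun)
    (ev_inj : injective ev)
    (Gamma1_gen : V_generating_set (range ev))
    (Gamma1_id : range ev Some) :
  (@DCF (Gamma1 + bool)%type `&` @DCFrev (Gamma1 + bool)%type) (L_V ev).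
Proof.
have ev_RI a : RIfin (ev a).
  have [/(_ (ev a)) evV _ _] := Gamma1_gen.
  by have [|f _ []] := evV; first by exists a.
split; first by apply: L_V_DCF => a; exact: RIfin_local.
rewrite /DCFrev /= rev_lang_L_V; last by move=> a; case: (ev_RI a).
by apply: L_V_DCF => a; exact: RIfin_pinv_local.
Qed.
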